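(* Let $N$ be a Poisson process on $[0,\infty)$ with intensity $\lambda>0$, with points $0<X_1<X_2<\cdots$, and let $\epsilon>0$, $L>0$. For every integer $n\ge0$, $$\Pr(\beta_0(L)=n)=\frac{1}{n!}\sum_{i=0}^{\lfloor L/\epsilon\rfloor-n}\frac{(-1)^i}{i!}\Big(\big(L-(n+i)\epsilon\big)\lambda e^{-\lambda\epsilon}\Big)^{n+i},$$ where an empty sum is $0$.
   Context: A cluster is a maximal set of consecutive points $X_j,\dots,X_k$ with $X_{l+1}-X_l\le\epsilon$ for $j\le l<k$; its end is $X_k+\epsilon$. $\beta_0(L)$ is the number of clusters whose end is $\le L$ (number of complete clusters, i.e. connected components, in $[0,L]$). *)

(* Defs.v *)
From HB Require Import structures.
From mathcomp Require Import all_boot all_order all_algebra.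
From mathcomp Require Import all_classical all_reals all_analysis.
Set Implicit Arguments. Unset Strict Implicit. Unset Printing Implicit Defensive.
Import Order.TTheory GRing.Theory Num.Theory.
Local Open Scope classical_set_scope.
Local Open Scope ring_scope.

(* Points of the process: [X k] is the (k+1)-th point X_{k+1} (0-indexed). *)
Definition interarrival {T : Type} {R : realType} (X : nat -> T -> R) (k : nat)
  : T -> R :=
  fun w => if k is k'.+1 then X k w - X k' w else X 0%N w.

(* Mutual independence of a sequence of real random variables: for every n,
   the first n of them satisfy the product rule on Borel sets (every finite
   subfamily is contained in some initial segment, taking B i = setT). *)
Definition mutually_independent d (T : measurableType d) (R : realType)
  (P : probability T R) (Y : nat -> T -> R) : Prop :=
  forall (n : nat) (B : nat -> set R), (forall i, measurable (B i)) ->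
    P (\bigcap_(i in [set i | (i < n)%N]) (Y i @^-1` B i)) =
    (\prod_(i < n) P (Y i @^-1` B i))%E.

Definition poisson_process d (T : measurableType d) (R : realType)
  (P : probability T R) (lam : R) (X : nat -> T -> R) : Prop :=
  (forall k, measurable_fun setT (X k)) /\
  (forall k (B : set R), measurable B ->
      P (interarrival X k @^-1` B) = exponential_prob lam B) /\
  mutually_independent P (interarrival X).

(* Indices (0-based) k such that X k is the last point of a cluster whose
   end X k + eps is <= L. The cluster containing X k ends at X k iff the gap
   to the next point exceeds eps. *)
Definition complete_cluster_ends {T : Type} {R : realType} (X : nat -> T -> R)
  (eps L : R) (w : T) : set nat :=
  [set k | eps < X k.+1 w - X k w /\ X k w + eps <= L].

Definition beta0_eq {T : Type} {R : realType} (X : nat -> T -> R)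
  (eps L : R) (n : nat) : set T :=
  [set w | exists s : seq nat, [/\ uniq s, size s = n &
      forall k, complete_cluster_ends X eps L w k <-> k \in s]].

(* Main.v *)
(** Let S_k be the k-th arrival and call a gap long when it exceeds eps. The
    (m+1)-subsets of complete clusters are indexed by their last member k and by
    m earlier long gaps. By lack of memory, prescribing m+1 long gaps costs a
    factor exp(- lam eps)^(m+1) and delays the k-th arrival by m eps, so that
    E['C(beta0(L), m)] is exp(- lam eps)^m times the m-th binomial moment
    (lam t)^m / m! of the number of Poisson points in [0, t], t = L - m eps.
    Since beta0(L) <= L / eps almost surely, binomial inversion is a finite sum.
    All moments are computed for the first K points, and K tends to infinity. *)

Require Import Defs.
From HB Require Import structures.
From mathcomp Require Import all_boot all_order all_algebra.
From mathcomp Require Import all_classical all_reals all_analysis.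
From mathcomp Require Import measurable_realfun ring zify.
Set Implicit Arguments.
Unset Strict Implicit.
Unset Printing Implicit Defensive.
Import Order.TTheory GRing.Theory Num.Theory.
Import numFieldNormedType.Exports.

(** * Counting *)

(* An (m+1)-subset of the marked indices is classified by its largest element. *)
Lemma bin_sum_last (e l : pred nat) m K : (forall k, l k.+1 -> l k) ->
  'C(\sum_(k < K) (e k && l k), m.+1) =
  (\sum_(k < K) (e k && l k) * 'C(\sum_(j < k) e j, m))%N.
Proof.
move=> hl; elim: K => [|K IH]; first by rewrite !big_ord0 bin0n.
rewrite !big_ord_recr /= -IH.
have [/andP[_ lK]|_] := boolP (e K && l K); last by rewrite addn0 mul0n addn0.
have hd j i : l (j + i)%N -> l j.
  by elim: i => [|i IHi]; rewrite ?addn0// addnS => /hl.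
have hj j : (j <= K)%N -> l j by move=> jK; apply: (hd _ (K - j)%N); rewrite subnKC.
rewrite (eq_bigr (fun j : 'I_K => nat_of_bool (e j))) => [|j _]; last first.
  by rewrite hj ?andbT// ltnW.
by rewrite addn1 binS mul1n.
Qed.

(** Turns a binomial coefficient of a random count into a sum of indicators, to which linearity of
    expectation applies. *)
Lemma bin_sum_subsets (e : pred nat) k m :
  'C(\sum_(j < k) e j, m) =
  (\sum_(J : {set 'I_k} | #|J| == m) [forall j in J, e j])%N.
Proof.
have -> : (\sum_(j < k) e j)%N = #|[set j : 'I_k | e j]|.
  by rewrite -sum1dep_card [RHS]big_mkcond; apply: eq_bigr => j _; case: (e j).
rewrite -cards_draws -sum1dep_card [LHS]big_mkcond [RHS]big_mkcond.
apply: eq_bigr => J _; case: eqP => _; rewrite ?andbT ?andbF//.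
congr (nat_of_bool _); apply/fintype.subsetP/forall_inP => h j /h; by rewrite inE.
Qed.

Local Open Scope classical_set_scope.
Local Open Scope ring_scope.

(** For n <= b the sum is ['C(b, n)] times the expansion of (1 - 1)^(b - n), which is nonzero only
    for b = n. Terms with n + i > b vanish, so the sum may stop at any upper bound M of b, and one M
    serves all values of a random count. *)
Lemma binomial_inversion (R : pzRingType) (b n M : nat) : (b <= M)%N ->
  (b == n)%:R = \sum_(i < M.+1 - n) (-1) ^+ i * 'C(n + i, n)%:R * 'C(b, n + i)%:R :> R.
Proof.
move=> bM; have [bn|nb] := ltnP b n.
  rewrite ltn_eqF// big1// => i _; rewrite (@bin_small b) ?mulr0//.
  exact: leq_trans bn (leq_addr _ _).
have binE i : ('C(n + i, n) * 'C(b, n + i) = 'C(b, n) * 'C(b - n, i))%N.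
  (* Trinomial revision: choosing n + i of b and then n of these amounts to choosing n of b and then
     i of the rest. *)
  have [ib|bi] := leqP i (b - n); last first.
    by rewrite (@bin_small (b - n))// (@bin_small b) ?muln0//; lia.
  have h1 := bin_fact (leq_addr i n); have nib : (n + i <= b)%N by lia.
  have h2 := bin_fact nib; have h3 := bin_fact nb; have h4 := bin_fact ib.
  rewrite addKn in h1; rewrite -subnDA in h4.
  have f0 : (0 < n`! * i`! * (b - (n + i))`!)%N by rewrite !muln_gt0 !fact_gt0.
  apply/eqP; rewrite -(eqn_pmul2r f0); apply/eqP.
  transitivity (b`!); last by rewrite -h3 -h4; ring.
  by rewrite -h2 -h1; ring.
transitivity (\sum_(i < (b - n).+1) 'C(b, n)%:R * ((-1) ^+ i * 'C(b - n, i)%:R) : R).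
  rewrite -mulr_sumr; have := @exprDn_comm R 1 (-1) (b - n) (commr_sym (commr1 _)).
  rewrite subrr expr0n; under eq_bigr do rewrite expr1n mul1r -mulr_natr.
  move=> <-; have [->|bn] := eqVneq b n; first by rewrite subnn binn mulr1.
  by rewrite (_ : (b - n == 0)%N = false) ?mulr0//; lia.
have le : ((b - n).+1 <= M.+1 - n)%N by lia.
rewrite (big_ord_widen _ (fun i => 'C(b, n)%:R * ((-1) ^+ i * 'C(b - n, i)%:R)) le).
rewrite big_mkcond; apply: eq_bigr => i _; rewrite -mulrA -natrM binE.
case: ltnP => h; last by rewrite (@bin_small (b - n)) ?muln0 ?mulr0.
by rewrite natrM !mulrA; congr (_ * _); rewrite mulr_natl mulr_natr.
Qed.

Lemma count_iota_sum (p : pred nat) K : (\sum_(k < K) p k)%N = count p (iota 0 K).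
Proof.
elim: K => [|K IH]; first by rewrite big_ord0.
by rewrite big_ord_recr [LHS]/= IH -[K.+1]addn1 iotaD count_cat /= add0n addn0.
Qed.

(** Having exactly n elements becomes two statements on partial counts: they reach n and never
    exceed it. In the application each is expressed by a countable union of events. *)
Lemma finite_count_iotaP (p : pred nat) n :
  (exists s : seq nat, [/\ uniq s, size s = n & forall k, p k <-> k \in s]) <->
  (exists K, n <= \sum_(k < K) p k)%N /\ ~ (exists K, n < \sum_(k < K) p k)%N.
Proof.
have fu K : uniq (seq.filter p (iota 0 K)) by rewrite filter_uniq ?iota_uniq.
split=> [[s [us <- ps]]|[[K nK] nn]].
  split.
    exists (\max_(k <- s) k).+1; rewrite count_iota_sum -size_filter.
    apply: uniq_leq_size => // k ks; rewrite mem_filter mem_iota /= add0n ltnS.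
    by rewrite (leq_bigmax_seq _ ks)// andbT; exact/ps.
  move=> [K]; rewrite count_iota_sum -size_filter ltnNge => /negP; apply.
  by apply: uniq_leq_size => // k; rewrite mem_filter => /andP[/ps].
exists (seq.filter p (iota 0 K)); split => //.
  rewrite size_filter -count_iota_sum; apply/eqP; rewrite eqn_leq nK andbT leqNgt.
  by apply/negP => h; apply: nn; exists K.
move=> k; rewrite mem_filter mem_iota /= add0n; split => [pk|/andP[]//].
(* An element k >= K would raise the count over the first k + 1 indices above n. *)
rewrite pk /= ltnNge; apply/negP => Kk; apply: nn; exists k.+1.
rewrite big_ord_recr /= pk addn1 ltnS; apply: leq_trans nK _.
by rewrite !count_iota_sum -(subnKC Kk) iotaD count_cat leq_addr.
Qed.

(** * Joint law of an independent pair with one exponential component *)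

Section JointLaw.
Context d (T : measurableType d) (R : realType) (P : probability T R).
Variables (A : set T) (mA : measurable A).

(** The finite, unnormalised law of [Z] on the event [A]. The measurability proofs are parameters so
    that the measure structures can be attached to this term. *)
Definition law_on (_ : measurable A) d' (T' : measurableType d') (Z : T -> T')
  (_ : measurable_fun setT Z) : set T' -> \bar R :=
  fun B => P (A `&` Z @^-1` B).

Section LawOn.
Context d' (T' : measurableType d') (Z : T -> T') (mZ : measurable_fun setT Z).

Local Lemma law_onE : law_on mA mZ = pushforward (mrestr P mA) Z.
Proof. by apply/funext => B; rewrite /law_on /pushforward /mrestr setIC. Qed.

Local Lemma law_on0 : law_on mA mZ set0 = 0%E.
Proof. by rewrite /law_on preimage_set0 setI0 measure0. Qed.

Local Lemma law_on_ge0 B : (0 <= law_on mA mZ B)%E.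
Proof. exact: measure_ge0. Qed.

Local Lemma law_on_sigma_additive : semi_sigma_additive (law_on mA mZ).
Proof. rewrite law_onE; exact: measure_semi_sigma_additive. Qed.

HB.instance Definition _ := isMeasure.Build _ _ _ (law_on mA mZ)
  law_on0 law_on_ge0 law_on_sigma_additive.

Local Lemma law_on_fin : fin_num_fun (law_on mA mZ).
Proof.
move=> B mB; apply: fin_num_measure; apply: measurableI => //.
by rewrite -[X in measurable X]setTI; exact: mZ.
Qed.

HB.instance Definition _ := Measure_isFinite.Build _ _ _ (law_on mA mZ) law_on_fin.

End LawOn.

Lemma measurable_snd_add (B D : set R) : measurable B -> measurable D ->
  measurable [set z : measurableTypeR R * measurableTypeR R |
    B z.2 /\ D (z.1 + z.2)].
Proof.
move=> mB mD; apply: measurableI.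
  have := @measurable_snd _ _ (measurableTypeR R) (measurableTypeR R)
    measurableT B mB.
  by rewrite setTI.
have : measurable_fun setT
    (fun z : measurableTypeR R * measurableTypeR R => (z.1 : R) + z.2).
  by apply: measurable_funD; [exact: measurable_fst|exact: measurable_snd].
by move=> /(_ measurableT D mD); rewrite setTI.
Qed.

(** The hypothesis on rectangles identifies the joint law on [A] with a product measure, by
    uniqueness of the latter. Tonelli then integrates over [Z] first and leaves the exponential
    density in y. *)
Lemma joint_law_density (lam : R) (Z G : T -> measurableTypeR R)
    (E : set (measurableTypeR R * measurableTypeR R)) :
  0 < lam -> measurable_fun setT Z -> measurable_fun setT G ->
  (forall B C, measurable B -> measurable C ->
    P (A `&` Z @^-1` B `&` G @^-1` C) =
    (P (A `&` Z @^-1` B) * exponential_prob lam C)%E) ->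
  measurable E ->
  P (A `&` (fun w => (Z w, G w)) @^-1` E) =
  (\int[lebesgue_measure]_y
     ((exponential_pdf lam y)%:E * P (A `&` Z @^-1` ysection E y)))%E.
Proof.
move=> lam0 mZ mG indep mE.
have mZG : measurable_fun setT (fun w => (Z w, G w)) by exact: measurable_fun_pair.
pose nu := law_on mA mZ.
have pdf0 y : (0 <= (exponential_pdf lam y)%:E)%E.
  by rewrite lee_fin exponential_pdf_ge0// ltW.
pose Pr : probability _ R := exponential_prob lam.
pose pdf2 : measurableTypeR R * measurableTypeR R -> R := fun z => exponential_pdf lam z.2.
have mpdf : measurable_fun setT pdf2.
  apply: measurableT_comp; last exact: measurable_snd.
  exact: measurable_exponential_pdf.
have -> : P (A `&` (fun w => (Z w, G w)) @^-1` E) = law_on mA mZG E by [].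
transitivity ((nu \x Pr lam0)%E E).
  have := @product_measure_unique _ _ _ _ _ nu (Pr lam0) (law_on mA mZG).
  move=> /(_ _ E mE) h; apply/esym/h.
  move=> B C mB mC; rewrite /= /nu /law_on -indep//; congr (P _).
  by rewrite -setIA; congr (_ `&` _); apply/seteqP; split.
transitivity (\int[nu]_x \int[lebesgue_measure]_y
    ((exponential_pdf lam y)%:E * (\1_E (x, y))%:E))%E.
  apply: eq_integral => x _ /=.
  rewrite /exponential_prob [LHS]integral_mkcond; apply: eq_integral => y _.
  rewrite patchE mem_xsection indicE.
  by case: ifPn => _; rewrite ?mule1 ?mule0.
rewrite (fubini_tonelli (fun z => (pdf2 z)%:E * (\1_E z)%:E)%E)//=; last 2 first.
- apply: emeasurable_funM; apply/measurable_EFinP => //; exact: measurable_indic.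
- by move=> z; rewrite mule_ge0// lee_fin// exponential_pdf_ge0// ltW.
apply: eq_integral => y _.
transitivity (\int[nu]_x ((exponential_pdf lam y)%:E *
    (EFin \o (fun x => \1_E (x, y)) : _ -> \bar R) x))%E => //.
rewrite ge0_integralZl//.
- congr (_ * _)%E.
  have := indic_fubini_tonelli_GE nu mE.
  by rewrite /fubini_G => /(congr1 (@^~ y)) /= ->.
- apply/measurable_EFinP.
  by apply: measurableT_comp => //.
- by move=> x _; rewrite /= lee_fin.
Qed.
End JointLaw.

(** * Erlang distributions *)

Section Erlang.
Context (R : realType).
Implicit Types lam x c s : R.

(* For k = 0 this is the distribution function of the unit mass at 0. *)
Definition erlang_cdf lam k x : R :=
  if 0 <= x then 1 - expR (- (lam * x)) * \sum_(j < k) (lam * x) ^+ j / j`!%:R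
  else 0.

(** Antiderivative, for y <= s, of the convolution integrand of the exponential density with
    [erlang_cdf lam k]. As e^(-lam y) e^(-lam (s - y)) = e^(-lam s) is constant in y, only a
    polynomial is left to integrate beyond the first term. *)
Definition erlang_primitive lam k s (y : R) : R :=
  - expR (- (lam * y)) +
  expR (- (lam * s)) * \sum_(j < k) (lam * (s - y)) ^+ j.+1 / j.+1`!%:R.

Lemma is_derive_erlang_primitive lam k s y : y <= s ->
  is_derive y (1:R) (erlang_primitive lam k s)
    (lam * expR (- lam * y) * erlang_cdf lam k (s - y)).
Proof.
move=> ys; rewrite /erlang_cdf subr_ge0 ys /erlang_primitive.
have h1 : is_derive y (1:R) (fun y => - expR (- (lam * y))) (lam * expR (- lam * y)).
  apply: is_derive_eq; rewrite /GRing.scale/=; rewrite mulNr; ring.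
have h2 j : is_derive y (1:R) (fun y => (lam * (s - y)) ^+ j.+1 / j.+1`!%:R)
    (- lam * ((lam * (s - y)) ^+ j / j`!%:R)).
  have -> : - lam * ((lam * (s - y)) ^+ j / j`!%:R) =
      ((j.+1)%:R * (lam * (s - y)) ^+ j * (- lam)) / j.+1`!%:R.
    rewrite factS natrM; field.
    by rewrite addrC natr1 !pnatr_eq0 -!lt0n fact_gt0.
  set c := (X in _ * X).
  have hl : is_derive y (1:R) (fun y => lam * (s - y)) (- lam).
    apply: is_derive_eq; rewrite /GRing.scale/=; ring.
  have -> : (fun y => (lam * (s - y)) ^+ j.+1 * c) =
      ((fun y => lam * (s - y)) ^+ j.+1 * cst c).
    by apply/funext => z; rewrite !fctE.
  apply: is_derive_eq; rewrite /GRing.scale/=; ring.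
have -> : (fun y => - expR (- (lam * y)) + expR (- (lam * s)) *
    (\sum_(j < k) (lam * (s - y)) ^+ j.+1 / (j.+1)`!%:R)) =
  ((fun y => - expR (- (lam * y))) + (expR (- (lam * s))) \*:
    (\sum_(j < k) (fun y => (lam * (s - y)) ^+ j.+1 / (j.+1)`!%:R))).
  by apply/funext => z; rewrite !fctE fct_sumE.
have h3 := is_derive_sum (fun j : 'I_k => h2 j).
apply: is_derive_eq; rewrite /GRing.scale/= -mulr_sumr.
have -> : - (lam * s) = - lam * y + - (lam * (s - y)) by ring.
rewrite expRD; ring.
Qed.

(** Analytic form of the lack of memory: convolving with the part of the exponential law beyond c
    raises the Erlang order by one, costs e^(-lam c) and shifts the argument by c. *)
Lemma integral_exp_erlang_cdf lam k c s :
  (\int[lebesgue_measure]_(y in `[c, +oo[)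
     (lam * expR (- lam * y) * erlang_cdf lam k (s - y))%:E)%E =
  (expR (- (lam * c)) * erlang_cdf lam k.+1 (s - c))%:E.
Proof.
(* The branch of the integrand for y <= s, continued to the whole line, where it is continuous. *)
pose g y := lam * expR (- lam * y) *
  (1 - expR (- (lam * (s - y))) * \sum_(j < k) (lam * (s - y)) ^+ j / j`!%:R).
transitivity (\int[lebesgue_measure]_(y in `[c, s]) (g y)%:E)%E.
  rewrite integral_mkcond [RHS]integral_mkcond; apply: eq_integral => y _.
  rewrite !patchE !mem_setE !in_itv/= andbT /erlang_cdf subr_ge0.
  by case: (c <= y) => //=; case: ifP => // _; rewrite mulr0.
rewrite /erlang_cdf subr_ge0; case: ifPn => [|/negbTE cs]; last first.
  by rewrite set_itv_ge ?integral_set0 ?mulr0// bnd_simp cs.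
(* For c = s the interval is a point, and the right-hand side vanishes because the sum in
   [erlang_cdf] reduces to its term j = 0. *)
rewrite le_eqVlt => /predU1P[<-|cs].
  rewrite set_itv1 integral_set1 subrr mulr0 oppr0 expR0 mul1r big_ord_recl.
  rewrite expr0 fact0 divr1 big1 ?addr0 ?subrr ?mulr0// => j _.
  by rewrite expr0n mul0r.
rewrite (@continuous_FTC2 _ g (erlang_primitive lam k s) c s cs).
- rewrite -EFinB; congr EFin; rewrite /erlang_primitive subrr mulr0.
  rewrite (eq_bigr (fun=> 0)) => [|j _]; last by rewrite expr0n mul0r.
  rewrite big1// big_ord_recl expr0 fact0 divr1.
  have -> : - (lam * s) = - (lam * c) + - (lam * (s - c)) by ring.
  rewrite expRD -[\sum_(i < k) (_ ^+ lift ord0 i / _)]/(\sum_(j < k)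
    (lam * (s - c)) ^+ j.+1 / (j.+1)`!%:R).
  ring.
- apply: continuous_subspaceT => y.
  pose q := \poly_(j < k) (j`!%:R^-1 : R).
  have -> : g = fun y => lam * expR (- lam * y) *
      (1 - expR (- (lam * (s - y))) * q.[lam * (s - y)]).
    apply/funext => z; rewrite /g horner_poly; congr (_ * (_ - _ * _)).
    by apply: eq_bigr => j _; rewrite mulrC.
  have cl : {for y, continuous (fun y => lam * (s - y))}.
    by apply: cvgM; [exact: cvg_cst|apply: cvgB; [exact: cvg_cst|exact: cvg_id]].
  apply: cvgM.
    apply: cvgM; first exact: cvg_cst.
    apply: continuous_comp; last exact: continuous_expR.
    by apply: cvgM; [exact: cvg_cst|exact: cvg_id].
  apply: cvgB; first exact: cvg_cst.
  apply: cvgM; last by apply: continuous_comp cl _; exact: continuous_horner.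
  apply: continuous_comp; last exact: continuous_expR.
  exact: cvgN.
- have cont y : y <= s -> {for y, continuous (erlang_primitive lam k s)}.
    move=> ys; apply/differentiable_continuous/derivable1_diffP.
    exact: (@ex_derive _ _ _ _ _ _ _ (is_derive_erlang_primitive lam k ys)).
  split.
  + move=> y; rewrite in_itv/= => /andP[_ ys].
    exact: (@ex_derive _ _ _ _ _ _ _ (is_derive_erlang_primitive lam k (ltW ys))).
  + by apply: cvg_at_right_filter; apply: cont; exact: ltW.
  + by apply: cvg_at_left_filter; exact: cont.
- move=> y; rewrite in_itv/= => /andP[_ ys]; rewrite derive1E.
  rewrite (@derive_val _ _ _ _ _ _ _ (is_derive_erlang_primitive lam k (ltW ys))).
  by rewrite /erlang_cdf subr_ge0 ltW.
Qed.

Lemma measurable_erlang_cdf lam k : measurable_fun setT (erlang_cdf lam k).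
Proof.
apply: measurable_fun_ifT => //.
  by apply: measurable_fun_ler => //; exact: measurable_id.
have ml : measurable_fun setT (fun x : R => lam * x) by apply: measurable_funM => //.
apply: measurable_funB => //; apply: measurable_funM.
  by apply: measurableT_comp => //; exact: measurableT_comp.
apply: measurable_sum => j; apply: measurable_funM => //.
exact: measurable_funX.
Qed.

Lemma measurable_exp_erlang_cdf lam k s :
  measurable_fun setT (fun y : R => lam * expR (- lam * y) * erlang_cdf lam k (s - y)).
Proof.
apply: measurable_funM.
  by apply: measurable_funM => //; apply: measurableT_comp => //; exact: measurable_funM.
apply: (measurableT_comp (measurable_erlang_cdf lam k)).
exact: measurable_funB.
Qed.

(** * Exponential series and binomial moments of the Poisson law *)

Lemma cvg_sum_expR x : (fun n => \sum_(j < n) x ^+ j / j`!%:R) @ \oo --> expR x.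
Proof.
have -> : (fun n => \sum_(j < n) x ^+ j / j`!%:R) = series (exp_coeff x).
  by apply/funext => n; rewrite /series/= big_mkord.
exact: is_cvg_series_exp_coeff.
Qed.

Lemma sum_le_expR x n : 0 <= x -> \sum_(j < n) x ^+ j / j`!%:R <= expR x.
Proof.
move=> x0; rewrite -(cvg_lim _ (@cvg_sum_expR x))//.
apply: (@nondecreasing_cvgn_le _ (fun n => \sum_(j < n) x ^+ j / j`!%:R)).
  apply/nondecreasing_seqP => k; rewrite big_ord_recr lerDl.
  by rewrite mulr_ge0// ?exprn_ge0// invr_ge0.
by apply/cvg_ex; exists (expR x); exact: cvg_sum_expR.
Qed.

Lemma erlang_cdf_ge0 lam k x : 0 < lam -> 0 <= erlang_cdf lam k x.
Proof.
move=> lam0; rewrite /erlang_cdf; case: ifPn => // x0.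
rewrite subr_ge0 expRN mulrC ler_pdivrMr ?expR_gt0// mul1r.
by apply: sum_le_expR; rewrite mulr_ge0// ltW.
Qed.

(* Summation by parts. *)
Lemma sum_bin_erlang_cdf lam t m K : 0 <= t ->
  \sum_(k < K) 'C(k, m)%:R * erlang_cdf lam k.+1 t =
  (\sum_(j < K) 'C(j, m.+1)%:R * (expR (- (lam * t)) * ((lam * t) ^+ j / j`!%:R)))
  + 'C(K, m.+1)%:R * erlang_cdf lam K t.
Proof.
move=> t0; rewrite /erlang_cdf t0; elim: K => [|K IH].
  by rewrite !big_ord0 bin0n mul0r addr0.
rewrite !big_ord_recr/= IH binS natrD.
by set p := _ / K`!%:R; move: p => p; ring.
Qed.

(** This is the m-th binomial moment of the Poisson law of mean x: terms with j < m vanish, and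
    ['C(j, m)] / j! = 1 / (m! (j - m)!) leaves a shifted exponential series. *)
Lemma cvg_sum_bin_poisson x m :
  (fun K => \sum_(j < K) 'C(j, m)%:R * (expR (- x) * (x ^+ j / j`!%:R))) @ \oo
  --> x ^+ m / m`!%:R.
Proof.
rewrite -(cvg_shiftn m) /=.
have -> : (fun K => \sum_(j < K + m) 'C(j, m)%:R * (expR (- x) * (x ^+ j / j`!%:R))) =
   (fun K => (expR (- x) * (x ^+ m / m`!%:R)) * \sum_(j < K) x ^+ j / j`!%:R).
  apply/funext => K; rewrite addnC big_split_ord /= big1 ?add0r => [|j _]; last first.
    by rewrite bin_small ?mul0r.
  rewrite mulr_sumr; apply: eq_bigr => j _.
  have := bin_fact (leq_addr j m); rewrite addKn => /(congr1 (fun n => n%:R : R)).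
  rewrite !natrM => h; rewrite -h exprD.
  have h1 : (m`!%:R : R) != 0 by rewrite pnatr_eq0 -lt0n fact_gt0.
  have h2 : (j`!%:R : R) != 0 by rewrite pnatr_eq0 -lt0n fact_gt0.
  have h3 : ('C(m + j, m)%:R : R) != 0 by rewrite pnatr_eq0 -lt0n bin_gt0 leq_addr.
  by field; rewrite h1 h2 h3.
have E : expR (- x) * (x ^+ m / m`!%:R) * expR x = x ^+ m / m`!%:R.
  by rewrite mulrAC -expRD addNr expR0 mul1r.
by rewrite -[in X in _ --> X]E; apply: cvgM; [exact: cvg_cst|exact: cvg_sum_expR].
Qed.

(** By [sum_bin_erlang_cdf] the partial sum is a partial Poisson moment plus a boundary term. The
    latter is at most the tail of the moment series, so the limit follows by squeezing. *)
Lemma cvg_sum_bin_erlang_cdf lam t m : 0 < lam -> 0 <= t ->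
  (fun K => \sum_(k < K) 'C(k, m)%:R * erlang_cdf lam k.+1 t) @ \oo
  --> (lam * t) ^+ m.+1 / m.+1`!%:R.
Proof.
move=> lam0 t0.
have x0 : 0 <= lam * t by rewrite mulr_ge0// ltW.
set x := lam * t in x0 *.
pose p j := expR (- x) * (x ^+ j / j`!%:R).
have p0 j : 0 <= p j by rewrite !mulr_ge0 ?expR_ge0 ?exprn_ge0 ?invr_ge0.
pose A K := \sum_(j < K) 'C(j, m.+1)%:R * p j.
have cA : A @ \oo --> x ^+ m.+1 / m.+1`!%:R by exact: cvg_sum_bin_poisson.
have ndA : nondecreasing_seq A.
  by apply/nondecreasing_seqP => k; rewrite /A big_ord_recr lerDl mulr_ge0.
have leA K : A K <= x ^+ m.+1 / m.+1`!%:R.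
  rewrite -(cvg_lim _ cA)//; apply: nondecreasing_cvgn_le => //.
  by apply/cvg_ex; exists (x ^+ m.+1 / m.+1`!%:R).
apply: (@squeeze_cvgr _ _ _ _ A (cst (x ^+ m.+1 / m.+1`!%:R))) => //; last exact: cvg_cst.
apply: nearW => K; rewrite sum_bin_erlang_cdf// -/x -/(p _) -/(A K).
apply/andP; split; first by rewrite lerDl mulr_ge0// erlang_cdf_ge0.
rewrite -lerBrDl /erlang_cdf t0 mulr_sumr -/x.
(* The boundary term gives each Poisson weight with j >= K the factor ['C(K, m.+1)], which is at
   most the factor ['C(j, m.+1)] it has in [A]. *)
have cp : (fun J => 'C(K, m.+1)%:R * (\sum_(j < J) p j - \sum_(j < K) p j)) @ \oo -->
    'C(K, m.+1)%:R * (1 - \sum_(j < K) p j).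
  apply: cvgM; first exact: cvg_cst.
  apply: cvgB; last exact: cvg_cst.
  have -> : (1:R) = expR (- x) * expR x by rewrite -expRD addNr expR0.
  under eq_fun do rewrite -mulr_sumr.
  by apply: cvgM; [exact: cvg_cst|exact: cvg_sum_expR].
rewrite -(cvg_lim _ cp)//; apply: limr_le; first by apply/cvg_ex; eexists; exact: cp.
near=> J.
have KJ : (K <= J)%N by near: J; exact: nbhs_infty_ge.
rewrite (le_trans _ (lerB (leA J) (lexx (A K))))// /A -(subnKC KJ) !big_split_ord /=.
rewrite addrAC subrr add0r [leRHS]addrAC subrr add0r mulr_sumr.
apply: ler_sum => j _; rewrite ler_wpM2r// ler_nat.
by apply: leq_bin2l; exact: leq_addr.
Unshelve. all: by end_near. Qed.

End Erlang.

(** * Arrival times under constraints on the gaps *)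

Lemma exponential_prob_gt (R : realType) (lam c : R) : 0 < lam -> 0 <= c ->
  exponential_prob lam `]c, +oo[%classic = (expR (- (lam * c)))%:E.
Proof.
move=> lam0 c0; pose Pr : probability _ R := exponential_prob lam.
rewrite -setCitvl (_ : exponential_prob lam = Pr lam0)// probability_setC//=.
rewrite (_ : exponential_prob lam _ = (1 - expR (- (lam * c)))%:E).
  by rewrite -EFinB; congr EFin; ring.
transitivity (exponential_prob lam `[0, c]%classic).
  rewrite /exponential_prob integral_mkcond [RHS]integral_mkcond.
  apply: eq_integral => y _; rewrite !patchE !mem_setE !in_itv/=.
  by have [//|y0] := leP 0 y; case: ifP; rewrite ?lt0_exponential_pdf.
move: c0; rewrite le_eqVlt => /predU1P[<-|c0].
  by rewrite set_itv1 /exponential_prob integral_set1 mulr0 oppr0 expR0 subrr.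
by rewrite exponential_prob_itv0c// mulNr EFinB.
Qed.

Section PartialSums.
Context d (T : measurableType d) (R : realType) (P : probability T R).
Variables (lam : R) (Y : nat -> T -> R).
Hypotheses (lam0 : 0 < lam) (mY : forall k, measurable_fun setT (Y k))
  (expY : forall k (B : set R), measurable B -> P (Y k @^-1` B) = exponential_prob lam B)
  (indepY : mutually_independent P Y).

Definition arrival k (w : T) : R := \sum_(i < k) Y i w.

Lemma arrivalS k w : arrival k.+1 w = arrival k w + Y k w.
Proof. by rewrite /arrival big_ord_recr. Qed.

Lemma measurable_arrival k : measurable_fun setT (arrival k).
Proof. exact: measurable_sum. Qed.

Definition box (B : nat -> set R) n := \bigcap_(i in [set i | (i < n)%N]) (Y i @^-1` B i).

Lemma measurable_box B n : (forall i, measurable (B i)) -> measurable (box B n).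
Proof.
move=> mB; apply: bigcap_measurableType => i _.
by rewrite -[X in measurable X]setTI; exact: mY.
Qed.

Lemma boxS B n : box B n.+1 = box B n `&` Y n @^-1` B n.
Proof.
rewrite /box; apply/seteqP; split => w.
  move=> h; split; last by apply: h => /=.
  by move=> i /= ik; apply: h => /=; exact: ltnW.
move=> [h1 h2] i /=; rewrite ltnS leq_eqVlt => /predU1P[->//|]; exact: h1.
Qed.

Lemma box_split B k n : box B (k + n)%N = box B k `&`
  \bigcap_(i in [set i | (i < n)%N]) (Y (k + i)%N @^-1` B (k + i)%N).
Proof.
elim: n => [|n IH].
  rewrite addn0; apply/seteqP; split=> [w h|w []//]; split => // i //.
rewrite addnS boxS IH -setIA; congr (_ `&` _).
apply/seteqP; split => w.
  by move=> [h1 h2] i /=; rewrite ltnS leq_eqVlt => /predU1P[->//|]; exact: h1.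
move=> h; split; last by apply: h => /=.
by move=> i /= ik; apply: h => /=; exact: ltnW.
Qed.

(** Mutual independence speaks of rectangles only, whereas this event also constrains a sum.
    Induction on k integrates over the last summand; n and [B] stay general because at stage k the
    gap [Y k] counts as one of the later ones. *)
Lemma box_arrival_independent k n (B : nat -> set R) (D : set R) :
  (forall i, measurable (B i)) -> measurable D ->
  P (box B (k + n) `&` arrival k @^-1` D) =
  (P (box B k `&` arrival k @^-1` D) * \prod_(i < n) P (Y (k + i)%N @^-1` B (k + i)%N))%E.
Proof.
elim: k n B D => [|k IH] n B D mB mD.
  rewrite add0n.
  have -> : box B 0 = setT by apply/seteqP; split => // w _ i.
  have [D0|nD0] := pselect (D 0).
    have -> : arrival 0 @^-1` D = setT.
      by apply/seteqP; split => // w _; rewrite /= /arrival big_ord0.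
    by rewrite !setIT probability_setT mul1e; exact: indepY.
  have -> : arrival 0 @^-1` D = set0.
    by apply/seteqP; split => // w; rewrite /= /arrival big_ord0.
  by rewrite !setI0 !measure0 mul0e.
pose F m := \bigcap_(i in [set i | (i < m)%N]) (Y (k.+1 + i)%N @^-1` B (k.+1 + i)%N).
pose c m := (\prod_(i < m) P (Y (k.+1 + i)%N @^-1` B (k.+1 + i)%N))%E.
have mF m : measurable (F m).
  apply: bigcap_measurableType => i _.
  by rewrite -[X in measurable X]setTI; exact: mY.
have mbox := measurable_box k mB.
(* Replacing side k of the box by [C] lets the induction hypothesis, with m + 1 later gaps, split
   off [Y k]. *)
have step m C D' : measurable C -> measurable D' ->
    P (box B k `&` F m `&` arrival k @^-1` D' `&` Y k @^-1` C) =
    (P (box B k `&` arrival k @^-1` D') * (exponential_prob lam C * c m))%E.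
  move=> mC mD'.
  pose B' i := if i == k then C else B i.
  have mB' i : measurable (B' i) by rewrite /B'; case: ifP.
  have bB' : box B' k = box B k.
    by apply/seteqP; split=> w h i /= ik; have := h i ik; rewrite /= /B' ltn_eqF.
  have -> : box B k `&` F m `&` arrival k @^-1` D' `&` Y k @^-1` C =
      box B' (k + m.+1) `&` arrival k @^-1` D'.
    rewrite -addSnnS box_split boxS bB'.
    rewrite /B' eqxx; apply/seteqP; split => w.
      move=> [[[h1 h2] h3] h4]; split => //; split=> // i /= im.
      by rewrite gtn_eqF ?addSn ?ltnS ?leq_addr//; exact: h2.
    move=> [[[h1 h4] h2] h3]; split => //; split=> //; split => // i /= im.
    by have := h2 i im; rewrite /= gtn_eqF ?addSn ?ltnS ?leq_addr.
  rewrite IH// bB' big_ord_recl /= addn0 [B' k]/B' eqxx expY//; congr (_ * (_ * _))%E.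
  apply: eq_bigr => i _; rewrite /B' /bump /= add1n addnS -addSn.
  by rewrite gtn_eqF// addSn ltnS leq_addr.
pose E := [set z : measurableTypeR R * measurableTypeR R |
  B k z.2 /\ D (z.1 + z.2)].
have mE : measurable E by exact: measurable_snd_add.
(* The later gaps enter only through the constant [c m], so comparison with m = 0 eliminates the
   integral. *)
have density m : P (box B (k.+1 + m)%N `&` arrival k.+1 @^-1` D) =
    (\int[lebesgue_measure]_y ((exponential_pdf lam y)%:E *
       P (box B k `&` arrival k @^-1` ysection E y)) * c m)%E.
  rewrite box_split boxS.
  have -> : box B k `&` Y k @^-1` B k `&` F m `&` arrival k.+1 @^-1` D =
      (box B k `&` F m) `&` (fun w => (arrival k w, Y k w)) @^-1` E.
    apply/seteqP; split => w; rewrite /= !arrivalS.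
      by move=> [[[? ?] ?] ?].
    by move=> [[? ?] [? ?]].
  have law1 D' : measurable D' -> P (box B k `&` F m `&` arrival k @^-1` D') =
      (P (box B k `&` arrival k @^-1` D') * c m)%E.
    move=> mD'; have := step m setT D' measurableT mD'.
    by rewrite preimage_setT setIT -(expY 0)// preimage_setT probability_setT mul1e.
  rewrite (@joint_law_density _ _ _ P (box B k `&` F m) _ lam (arrival k) (Y k) E)//.
  - under eq_integral.
      move=> y _; rewrite law1; last exact: measurable_ysection.
      rewrite muleA; over.
    rewrite ge0_integralZr//.
    + apply: emeasurable_funM.
        by apply/measurable_EFinP; exact: measurable_exponential_pdf.
      have mA : measurable_fun setT (arrival k : T -> measurableTypeR R).
        exact: measurable_arrival.
      have := @measurable_fun_ysection _ _ _ (measurableTypeR R) R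
        (law_on P mbox mA) E mE.
      by [].
    + by move=> y _; rewrite mule_ge0// lee_fin exponential_pdf_ge0// ltW.
    + by apply: prode_ge0.
  - exact: measurableI.
  - exact: measurable_arrival.
  - exact: mY.
  - move=> D' C mD' mC; rewrite step// law1//.
    by rewrite -!muleA; congr (_ * _)%E; rewrite muleC.
by have := density 0; rewrite addn0 /c big_ord0 mule1 => ->; rewrite density.
Qed.

(** Lack of memory, gap by gap: each bound [a i] costs a factor exp(- lam a_i) and delays the
    arrival by a_i. *)
Lemma arrival_law (a : nat -> R) k t : (forall i, 0 <= a i) ->
  P (box (fun i => `]a i, +oo[%classic) k `&` arrival k @^-1` `]-oo, t]) =
  (expR (- (lam * \sum_(i < k) a i)) * erlang_cdf lam k (t - \sum_(i < k) a i))%:E.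
Proof.
move=> a0; elim: k t => [|k IH] t.
  rewrite !big_ord0 mulr0 oppr0 expR0 mul1r addr0 /erlang_cdf !big_ord0 mulr0 subr0.
  have -> : box (fun i => `]a i, +oo[%classic) 0 = setT by apply/seteqP; split => // w _ i.
  rewrite setTI; case: ifPn => t0.
    rewrite (_ : _ @^-1` _ = setT) ?probability_setT//.
    by apply/seteqP; split => // w _; rewrite /= /arrival big_ord0 in_itv.
  rewrite (_ : _ @^-1` _ = set0) ?measure0//.
  by apply/seteqP; split => // w; rewrite /= /arrival big_ord0 in_itv/= (negbTE t0).
pose B i : set R := `]a i, +oo[%classic.
have mB i : measurable (B i) by exact: measurable_itv.
have mbox := measurable_box k mB.
pose E := [set z : measurableTypeR R * measurableTypeR R |
  B k z.2 /\ `]-oo, t]%classic (z.1 + z.2)].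
have mE : measurable E by apply: measurable_snd_add => //; exact: measurable_itv.
have -> : box B k.+1 `&` arrival k.+1 @^-1` `]-oo, t] =
    box B k `&` (fun w => (arrival k w, Y k w)) @^-1` E.
  rewrite boxS /E /B; apply/seteqP; split => w; rewrite /= !arrivalS.
    by move=> [[? ?] ?].
  by move=> [? [? ?]].
rewrite (@joint_law_density _ _ _ P (box B k) _ lam (arrival k) (Y k) E)//; last 3 first.
- exact: measurable_arrival.
- exact: mY.
- move=> D C mD mC.
  pose B' i := if i == k then C else B i.
  have mB' i : measurable (B' i : set R).
    by rewrite /B'; case: ifP => _; [exact: mC|exact: mB].
  have bB' : box B' k = box B k.
    by apply/seteqP; split=> w h i /= ik; have := h i ik; rewrite /= /B' ltn_eqF.
  have := box_arrival_independent k 1 mB' mD.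
  rewrite addn1 boxS bB' big_ord1 addn0 /B' eqxx (expY k mC) => <-.
  by rewrite setIAC.
set K := expR _ in IH *; set s := \sum_(i < k) a i in K IH *.
have mg := measurable_exp_erlang_cdf lam k (t - s).
(* The section at y is empty for y <= a k, so the integral lives on an open half-line; closing it
   changes nothing for Lebesgue measure. *)
transitivity (\int[lebesgue_measure]_(y in `[a k, +oo[) ((lam * expR (- lam * y) *
   erlang_cdf lam k (t - s - y))%:E * K%:E))%E.
  rewrite -integral_itv_obnd_cbnd; last first.
    by apply: measurable_funTS; apply: emeasurable_funM => //; apply/measurable_EFinP.
  rewrite [RHS]integral_mkcond; apply: eq_integral => y _.
  rewrite patchE mem_setE in_itv/= andbT; case: ifPn => aky; last first.
    rewrite (_ : ysection E y = set0) ?preimage_set0 ?setI0 ?measure0 ?mule0//.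
    apply/seteqP; split => // x; rewrite ysectionE /E /B /= in_itv/= andbT.
    by rewrite (negbTE aky) => -[].
  rewrite (_ : ysection E y = `]-oo, t - y]%classic); last first.
    apply/seteqP; split => x; rewrite ysectionE /E /B /= !in_itv/= andbT lerBrDr.
      by case.
    by split.
  rewrite IH -!EFinM; congr EFin; rewrite exponential_pdfE; last first.
    exact: le_trans (a0 k) (ltW aky).
  by rewrite /K (addrAC t); ring.
rewrite ge0_integralZr//; last 3 first.
- by apply: measurable_funTS; apply/measurable_EFinP.
- move=> y _; rewrite lee_fin !mulr_ge0 ?expR_ge0 ?erlang_cdf_ge0 //; exact: ltW.
- by rewrite lee_fin expR_ge0.
rewrite integral_exp_erlang_cdf -EFinM big_ord_recr /= -/s.
rewrite mulrDr opprD expRD -/K opprD addrA; congr EFin; ring.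
Qed.
End PartialSums.

(** * Clusters *)

Section Mean.
Context d (T : measurableType d) (R : realType) (P : probability T R).

(** Integrability is bundled with the value, so that sums and scalings carry no separate side
    conditions. *)
Definition has_mean (f : T -> R) (v : R) :=
  P.-integrable setT (EFin \o f) /\ (\int[P]_w (f w)%:E)%E = v%:E.

Lemma has_mean_indic A : measurable A -> has_mean (\1_A) (fine (P A)).
Proof.
move=> mA; have fA : P A \is a fin_num by exact: fin_num_measure.
split; last by rewrite integral_indic// setIT fineK.
by apply: integrable_indic => //; rewrite -ge0_fin_numE.
Qed.

Lemma has_mean0 : has_mean (fun=> 0) 0.
Proof. by split; [exact: integrable0|rewrite integral0]. Qed.

Lemma has_meanD f g u v : has_mean f u -> has_mean g v ->
  has_mean (fun w => f w + g w) (u + v).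
Proof.
move=> [fi fu] [gi gv]; split; first exact: (integrableD measurableT fi gi).
by rewrite EFinD -fu -gv -integralD.
Qed.

Lemma has_meanZ k f v : has_mean f v -> has_mean (fun w => k * f w) (k * v).
Proof.
move=> [fi fv]; split; first exact: (integrableZl measurableT k fi).
by rewrite EFinM -fv -integralZl.
Qed.

Lemma has_mean_sum (I : Type) (r : seq I) (Q : pred I) (f : I -> T -> R) (v : I -> R) :
  (forall i, Q i -> has_mean (f i) (v i)) ->
  has_mean (fun w => \sum_(i <- r | Q i) f i w) (\sum_(i <- r | Q i) v i).
Proof.
move=> h; elim: r => [|i r IH].
  by rewrite big_nil; under eq_fun do rewrite big_nil; exact: has_mean0.
rewrite big_cons; under eq_fun do rewrite big_cons.
by case: ifPn => // Qi; exact: has_meanD (h i Qi) IH.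
Qed.

Lemma prob_ae_eq_mean A f v : measurable A -> has_mean f v ->
  (\forall w \ae P, \1_A w = f w) -> P A = v%:E.
Proof.
move=> mA [fi <-] h.
rewrite -(setIT A) -integral_indic//; apply: ae_eq_integral => //.
- by apply/measurable_EFinP; exact: measurable_indic.
- exact: measurable_int fi.
- by apply: filterS h => w /= -> _.
Qed.
End Mean.

(** * Complete clusters among the first K points *)

Section Clusters.
Context d (T : measurableType d) (R : realType) (P : probability T R).
Variables (lam eps L : R) (X : nat -> T -> R).
Hypotheses (lam0 : 0 < lam) (eps0 : 0 < eps) (L0 : 0 < L)
  (XP : poisson_process P lam X).

Let Y := interarrival X.

Local Lemma measurable_interarrival k : measurable_fun setT (Y k).
Proof.
case: XP => mX _; case: k => [|k]; first exact: mX.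
by apply: measurable_funB; exact: mX.
Qed.

Local Lemma exponential_interarrival k (B : set R) : measurable B ->
  P (Y k @^-1` B) = exponential_prob lam B.
Proof. by case: XP => _ [+ _]; exact. Qed.

Local Lemma independent_interarrival : mutually_independent P Y.
Proof. by case: XP => _ []. Qed.

Local Lemma arrivalE k w : arrival Y k.+1 w = X k w.
Proof.
elim: k => [|k IH]; first by rewrite /arrival big_ord1.
by rewrite arrivalS IH /Y /= addrC subrK.
Qed.

Definition cluster_end w k := (eps < X k.+1 w - X k w) && (X k w + eps <= L).

Definition cluster_count K w := (\sum_(k < K) cluster_end w k)%N.

(** [poisson_process] prescribes laws, so the points are ordered only almost surely; the pathwise
    counting identities below assume this positivity. *)
Lemma ae_interarrival_gt0 : \forall w \ae P, forall k, 0 < Y k w.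
Proof.
apply: ae_foralln => k; exists (~` (Y k @^-1` `]0, +oo[)).
have mk : measurable (Y k @^-1` `]0, +oo[).
  by rewrite -[X in measurable X]setTI; apply: measurable_interarrival.
have P0 : P (~` (Y k @^-1` `]0, +oo[)) = 0%E.
  rewrite probability_setC// exponential_interarrival//.
  by rewrite exponential_prob_gt// mulr0 oppr0 expR0 subee.
split; [exact: measurableC|exact: P0|].
by move=> w /=; apply: contra_not; rewrite in_itv/= andbT.
Qed.

(* Requires gaps longer than eps after the (0-based) points in J and after the
   point k; the other gaps are only required to be positive. *)
Definition gap_bound k (J : {set 'I_k}) (i : nat) : R :=
  if i is i'.+1 then
    oapp (fun j : 'I_k => if j \in J then eps else 0) eps (insub i')
  else 0.
Arguments gap_bound : simpl never.

Lemma gap_bound_ge0 k (J : {set 'I_k}) i : 0 <= gap_bound J i.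
Proof.
rewrite /gap_bound; case: i => //= i; case: insubP => /= [j _ _|_]; last exact: ltW.
by case: ifP => // _; exact: ltW.
Qed.

Lemma gap_bound_ord k (J : {set 'I_k}) (j : 'I_k) :
  gap_bound J j.+1 = if j \in J then eps else 0.
Proof. by rewrite /gap_bound /= valK. Qed.

Lemma gap_bound_last k (J : {set 'I_k}) : gap_bound J k.+1 = eps.
Proof. by rewrite /gap_bound /= insubF// ltnn. Qed.

(** The range stops before index [k.+1]: the gap after point k does not delay that point. *)
Lemma sum_gap_bound k (J : {set 'I_k}) : \sum_(i < k.+1) gap_bound J i = #|J|%:R * eps.
Proof.
rewrite big_ord_recl add0r (eq_bigr (fun j : 'I_k => if j \in J then eps else 0)).
  by rewrite -big_mkcond sumr_const mulr_natl.
by move=> j _; rewrite -gap_bound_ord.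
Qed.

(* Almost surely, the points of J and the point k all end complete clusters: for
   those of J, the constraint X j + eps <= L follows from the one on X k. *)
Definition marked_event k (J : {set 'I_k}) : set T :=
  box Y (fun i => `]gap_bound J i, +oo[%classic) k.+2 `&`
  arrival Y k.+1 @^-1` `]-oo, L - eps].

Lemma measurable_marked_event k (J : {set 'I_k}) : measurable (marked_event J).
Proof.
apply: measurableI.
  by apply: measurable_box => // i; exact: measurable_interarrival.
rewrite -[X in measurable X]setTI; apply: measurable_arrival => //.
exact: measurable_interarrival.
Qed.

(** [X k] depends on the gaps up to index k, so the long gap after it is an independent factor exp(-
    lam eps). The long gaps of [J] also delay [X k] by eps each; the remaining eps subtracted from L
    comes from X k + eps <= L. *)
Lemma prob_marked_event k (J : {set 'I_k}) : P (marked_event J) =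
  (expR (- (lam * eps)) ^+ #|J|.+1 * erlang_cdf lam k.+1 (L - #|J|.+1%:R * eps))%:E.
Proof.
rewrite /marked_event -[k.+2]addn1.
rewrite (box_arrival_independent lam0 measurable_interarrival
  exponential_interarrival independent_interarrival)//.
rewrite (arrival_law lam0 measurable_interarrival
  exponential_interarrival independent_interarrival); last exact: gap_bound_ge0.
rewrite big_ord1 exponential_interarrival// addn0 gap_bound_last.
rewrite exponential_prob_gt ?ltW// sum_gap_bound -EFinM; congr EFin.
rewrite exprSr -expRM_natl mulrAC; congr (_ * _); last first.
  by congr erlang_cdf; rewrite -natr1; ring.
by congr (expR _ * _); ring.
Qed.

(** Bounds equal to 0 are automatic for positive gaps, so only the prescribed long gaps and the
    deadline remain. *)
Lemma marked_eventE k (J : {set 'I_k}) w : (forall i, 0 < Y i w) ->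
  marked_event J w <-> cluster_end w k && [forall j in J, eps < Y j.+1 w].
Proof.
move=> Y0; rewrite /marked_event /cluster_end; split.
  move=> [h1 h2]; move: h2; rewrite /= in_itv/= arrivalE lerBrDr => ->.
  have := h1 k.+1 (ltnSn _); rewrite /= gap_bound_last in_itv/= !andbT => ->.
  apply/forall_inP => j jJ; have jk : (j.+1 < k.+2)%N by rewrite ltnS ltnW// ltnS.
  by have := h1 j.+1 jk; rewrite /preimage/= in_itv/= gap_bound_ord jJ andbT.
move=> /andP[/andP[ek lk] /forall_inP hJ]; split; last first.
  by rewrite /= in_itv/= arrivalE lerBrDr.
move=> i /= ik; rewrite in_itv/= andbT; case: i ik => [|i ik]; first by rewrite Y0.
have [ltik|] := ltnP i k.
  rewrite -[i.+1]/((Ordinal ltik).+1) gap_bound_ord.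
  by case: ifP => [/hJ|_]; rewrite ?Y0.
by rewrite leq_eqVlt => /predU1P[<-|]; 
  rewrite ?gap_bound_last// ltnNge (ik : (i <= k)%N).
Qed.

(** Closed form of the m-th binomial moment of [cluster_count K]. The case m = 0 is separate because
    an empty set of clusters has no last member. *)
Definition binom_mean m K : R :=
  if m is m'.+1 then
    expR (- (lam * eps)) ^+ m *
    \sum_(k < K) 'C(k, m')%:R * erlang_cdf lam k.+1 (L - m%:R * eps)
  else 1.

Definition binom_indic m K w : R :=
  if m is m'.+1 then
    \sum_(k < K) \sum_(J : {set 'I_k} | #|J| == m') \1_(marked_event J) w
  else 1.

Lemma has_mean_binom_indic m K : has_mean P (binom_indic m K) (binom_mean m K).
Proof.
case: m => [|m].
  have := has_mean_indic P measurableT.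
  by rewrite probability_setT indicT.
rewrite /binom_mean mulr_sumr; apply: has_mean_sum => k _.
rewrite (_ : _ * _ = \sum_(J : {set 'I_k} | #|J| == m) fine (P (marked_event J))).
  by apply: has_mean_sum => J _; apply: has_mean_indic; exact: measurable_marked_event.
rewrite (eq_bigr (fun=> expR (- (lam * eps)) ^+ m.+1 *
    erlang_cdf lam k.+1 (L - m.+1%:R * eps))); last first.
  by move=> J /eqP Jm; rewrite prob_marked_event Jm.
rewrite sumr_const -mulr_natl.
have -> : #|[pred J : {set 'I_k} | #|J| == m]| = 'C(k, m).
  by rewrite -[in RHS](card_ord k) -card_draws cardsE.
ring.
Qed.

(** The m-subsets of cluster ends are classified by their last member. Positive gaps make the
    deadline condition pass to earlier points, as [bin_sum_last] requires. *)
Lemma binom_indicE m K w : (forall i, 0 < Y i w) ->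
  binom_indic m K w = 'C(cluster_count K w, m)%:R.
Proof.
move=> Y0; case: m => [|m]; first by rewrite bin0.
rewrite /cluster_count /cluster_end.
rewrite (@bin_sum_last (fun k => eps < X k.+1 w - X k w)
  (fun k => X k w + eps <= L)); last first.
  by move=> k; apply: le_trans; rewrite lerD2r -subr_ge0 ltW//; exact: (Y0 k.+1).
rewrite natr_sum; apply: eq_bigr => k _.
rewrite (bin_sum_subsets (fun j => eps < X j.+1 w - X j w)).
rewrite natrM natr_sum mulr_sumr.
apply: eq_bigr => J _; rewrite -natrM mulnb indicE; congr (_%:R); congr nat_of_bool.
by apply/idP/idP; rewrite inE => /(marked_eventE _ Y0).
Qed.

(** Long gaps are disjoint intervals of length above eps. Those before a complete cluster end X K
    fit in [0, X K], and X K + eps <= L leaves room for one more eps. *)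
Lemma cluster_count_le K w : (forall i, 0 < Y i w) ->
  (cluster_count K w <= Num.truncn (L / eps))%N.
Proof.
move=> Y0; rewrite truncn_ge_nat; last by rewrite divr_ge0 ?ltW.
rewrite ler_pdivlMr//.
have gaps k : (\sum_(j < k) (eps < Y j.+1 w)%R)%:R * eps <= X k w.
  elim: k => [|k IH]; first by rewrite big_ord0 mul0r ltW//; exact: (Y0 0).
  rewrite big_ord_recr/= natrD mulrDl.
  have XS : X k.+1 w = X k w + Y k.+1 w by rewrite /Y /=; ring.
  rewrite [leRHS]XS.
  apply: lerD => //; case: (ltP eps (Y k.+1 w)) => h; first by rewrite mul1r ltW.
  by rewrite mul0r; exact: ltW (Y0 k.+1).
elim: K => [|K IH]; first by rewrite /cluster_count big_ord0 mul0r ltW.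
rewrite /cluster_count big_ord_recr/= -/(cluster_count K w).
have [/andP[_ lK]|_] := boolP (cluster_end w K); last by rewrite addn0.
rewrite natrD mulrDl mul1r; apply: le_trans lK; rewrite lerD2r.
apply: le_trans (gaps K); rewrite ler_pM2r// ler_nat; apply: leq_sum => j _.
rewrite /cluster_end -[X j.+1 w - X j w]/(Y j.+1 w).
by case: (eps < Y j.+1 w); case: (X j w + eps <= L).
Qed.

(** * From the first K points to the whole process *)

Definition at_least n K : set T := [set w | (n <= cluster_count K w)%N].

Lemma measurable_cluster_end k : measurable [set w | cluster_end w k].
Proof.
have [mX _] := XP.
have -> : [set w | cluster_end w k] =
    (fun w => X k.+1 w - X k w) @^-1` `]eps, +oo[ `&`
    (fun w => X k w + eps) @^-1` `]-oo, L].
  apply/seteqP; split => w; rewrite /cluster_end /= !in_itv/= andbT; first by move/andP.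
  by move=> [-> ->].
apply: measurableI.
  rewrite -[X in measurable X]setTI; have := measurable_funB (mX k.+1) (mX k).
  by apply => //; exact: measurable_itv.
rewrite -[X in measurable X]setTI.
have := measurable_funD (mX k) (measurable_cst eps : measurable_fun setT _).
by apply => //; exact: measurable_itv.
Qed.

Lemma measurable_at_least n K : measurable (at_least n K).
Proof.
elim: K n => [|K IH] n.
  rewrite /at_least; case: n => [|n].
    by rewrite (_ : [set _ | _] = setT)//; apply/seteqP.
  rewrite (_ : [set _ | _] = set0)//; apply/seteqP; split => // w /=.
  by rewrite /cluster_count big_ord0.
have -> : at_least n K.+1 = at_least n K `|`
    (at_least n.-1 K `&` [set w | cluster_end w K]).
  apply/seteqP; split => w; rewrite /at_least /= /cluster_count big_ord_recr /=.
    case: cluster_end; rewrite ?addn0; last by left.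
    by move=> h; right; split => //; lia.
  by move=> [h|[h ->]]; lia.
apply: measurableU => //; apply: measurableI => //; exact: measurable_cluster_end.
Qed.

Lemma at_least_nondecreasing n : {homo at_least n : K K' / (K <= K')%N >-> (K <= K')%O}.
Proof.
move=> K K' KK'; apply/subsetPset => w; rewrite /at_least /= => /leq_trans; apply.
by rewrite /cluster_count !count_iota_sum -(subnKC KK') iotaD count_cat leq_addr.
Qed.

(** The event that the first K points give exactly n ends is not monotone in K; a difference of
    increasing unions gives access to continuity from below. The second union also removes the
    outcomes with infinitely many ends. *)
Lemma beta0_eqE n : beta0_eq X eps L n =
  \bigcup_K at_least n K `\` \bigcup_K at_least n.+1 K.
Proof.
have endE w k : complete_cluster_ends X eps L w k <-> cluster_end w k.
  by rewrite /complete_cluster_ends /cluster_end; split => [[-> ->]|/andP].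
apply/seteqP; split => w.
  move=> [s [us ss hs]].
  have [|[K hK] hn] := (finite_count_iotaP (cluster_end w) n).1.
    by exists s; split => // k; split => [/endE/hs|/hs/endE].
  by split; [exists K|move=> [K' _ hK']; apply: hn; exists K'].
move=> [[K _ hK] hn].
have [|s [us ss hs]] := (finite_count_iotaP (cluster_end w) n).2.
  by split; [exists K|move=> [K' hK']; apply: hn; exists K'].
by exists s; split => // k; split => [/endE/hs|/hs/endE].
Qed.

Let M := Num.truncn (L / eps).

(** Almost surely the count is at most M, so [binomial_inversion] writes the indicator as a
    combination of [binom_indic] with a number of terms independent of K. *)
Lemma prob_cluster_count_eq n K : P (at_least n K `\` at_least n.+1 K) =
  (\sum_(i < M.+1 - n) (-1) ^+ i * 'C(n + i, n)%:R * binom_mean (n + i) K)%:E.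
Proof.
apply: (prob_ae_eq_mean (f :=
  fun w => \sum_(i < M.+1 - n) (-1) ^+ i * 'C(n + i, n)%:R * binom_indic (n + i) K w)).
- by apply: measurableD; exact: measurable_at_least.
- by apply: has_mean_sum => i _; apply: has_meanZ; exact: has_mean_binom_indic.
apply: filterS ae_interarrival_gt0 => w Y0.
under eq_bigr do rewrite binom_indicE//.
rewrite -binomial_inversion ?cluster_count_le// indicE; congr (nat_of_bool _)%:R.
apply/idP/eqP; rewrite inE /at_least /=.
  by move=> [h /negP]; rewrite -leqNgt => h'; apply/eqP; rewrite eqn_leq h'.
by move=> ->; split => //; rewrite ltnn.
Qed.

(** The bound m <= M means m eps <= L, so the Erlang argument L - m eps is nonnegative and the
    Poisson moment limit applies. *)
Lemma cvg_binom_mean m : (m <= M)%N ->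
  binom_mean m @ \oo -->
  ((L - m%:R * eps) * lam * expR (- (lam * eps))) ^+ m / m`!%:R.
Proof.
case: m => [|m] mM.
  by rewrite expr0 fact0 divr1; exact: cvg_cst.
have mL : m.+1%:R * eps <= L.
  move: mM; rewrite /M truncn_ge_nat; last by rewrite divr_ge0 ?ltW.
  by rewrite ler_pdivlMr.
have -> : ((L - m.+1%:R * eps) * lam * expR (- (lam * eps))) ^+ m.+1 / m.+1`!%:R =
    expR (- (lam * eps)) ^+ m.+1 * ((lam * (L - m.+1%:R * eps)) ^+ m.+1 / m.+1`!%:R).
  by rewrite mulrA -exprMn; congr (_ ^+ _ / _); ring.
apply: cvgM; first exact: cvg_cst.
by apply: cvg_sum_bin_erlang_cdf => //; rewrite subr_ge0.
Qed.

(** Continuity from below on both unions gives the limit of the differences, while the finite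
    inversion sum converges term by term. *)
Lemma prob_beta0_eq n : P (beta0_eq X eps L n) =
  (\sum_(i < M.+1 - n) (-1) ^+ i * 'C(n + i, n)%:R *
    (((L - (n + i)%:R * eps) * lam * expR (- (lam * eps))) ^+ (n + i) / (n + i)`!%:R))%:E.
Proof.
have mU m : measurable (\bigcup_K at_least m K).
  by apply: bigcupT_measurable => K; exact: measurable_at_least.
have sub m K : at_least m.+1 K `<=` at_least m K by move=> w; exact: ltnW.
have subU : \bigcup_K at_least n.+1 K `<=` \bigcup_K at_least n K.
  by move=> w [K _ h]; exists K => //; exact: sub.
have lty A : measurable A -> (P A < +oo)%E.
  by move=> mA; rewrite -ge0_fin_numE// fin_num_measure.
have cvgP m : (P \o at_least m) @ \oo --> P (\bigcup_K at_least m K).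
  apply: nondecreasing_cvg_mu => //; last exact: at_least_nondecreasing.
  by move=> K; exact: measurable_at_least.
have cvgD : (fun K => P (at_least n K) - P (at_least n.+1 K))%E @ \oo -->
    P (beta0_eq X eps L n).
  rewrite beta0_eqE measureD ?lty// (setIidr subU).
  apply: cvgeB; [|exact: cvgP|exact: cvgP].
  by rewrite fin_num_adde_defr// fin_num_measure.
rewrite -(cvg_lim _ cvgD)//; apply: cvg_lim => //.
rewrite (_ : (fun K => _) = EFin \o (fun K => \sum_(i < M.+1 - n)
    (-1) ^+ i * 'C(n + i, n)%:R * binom_mean (n + i) K)); last first.
  apply/funext => K /=; rewrite -prob_cluster_count_eq measureD ?lty//;
    try exact: measurable_at_least.
  by rewrite (setIidr (sub n K)).
apply: cvg_EFin; first exact: nearW.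
apply: cvg_big => [|i _]; first exact: add_continuous.
apply: cvgM; first exact: cvg_cst.
by apply: cvg_binom_mean; have := ltn_ord i; lia.
Qed.
End Clusters.

Theorem theorem3 (d : measure_display) (T : measurableType d) (R : realType)
  (P : probability T R) (lam eps L : R) (X : nat -> T -> R)
  (hlam : 0 < lam) (heps : 0 < eps) (hL : 0 < L)
  (hN : poisson_process P lam X) (n : nat) :
  P (beta0_eq X eps L n) =
  ((n`!%:R)^-1 *
   \sum_(i < (Num.truncn (L / eps)).+1 - n)
     ((-1) ^+ i / (i`!%:R) *
      ((L - (n + i)%:R * eps) * lam * expR (- (lam * eps))) ^+ (n + i)))%:E.
Proof.
rewrite (prob_beta0_eq hlam heps hL hN); congr EFin; rewrite mulr_sumr.
apply: eq_bigr => i _.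
(* The identity ['C(n + i, n)] / (n + i)! = 1 / (n! i!) separates the prefactor 1 / n!. *)
have := bin_fact (leq_addr i n); rewrite addKn => /(congr1 (fun m => m%:R : R)).
rewrite !natrM => <-.
have neq0 k : (k`!%:R : R) != 0 by rewrite pnatr_eq0 -lt0n fact_gt0.
have bin_neq0 : ('C(n + i, n)%:R : R) != 0.
  by rewrite pnatr_eq0 -lt0n bin_gt0 leq_addr.
by field; rewrite bin_neq0 !neq0.
Qed.
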